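(* Let $a>0$ and $N>0$, and define an inner product on the space $\mathbf{P}$ of real polynomials by $$\langle f,g\rangle=\sum_{x=0}^{\infty}\frac{e^{-a}a^x}{x!}f(x)g(x)+Nf(0)g(0),\qquad f,g\in\mathbf{P}.$$ For $n=0,1,2,\ldots$ set $$C_n^{a,N}(x)=\left[1+N(-1)^nC_n^{(a)}(-1)\right]C_n^{(a)}(x)-N(-1)^nC_n^{(a)}(0)\,C_n^{(a)}(x-1),$$ where $C_n^{(a)}$ denotes the classical Charlier polynomial. Then $\{C_n^{a,N}(x)\}_{n=0}^{\infty}$ is a sequence of polynomials with $\deg C_n^{a,N}=n$ for every $n$ which is orthogonal with respect to $\langle\cdot,\cdot\rangle$, i.e. $\langle C_m^{a,N},C_n^{a,N}\rangle=0$ whenever $m\neq n$.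
   Context: The classical Charlier polynomials are normalized by $$C_n^{(a)}(x):=\sum_{k=0}^n\binom{x}{k}\frac{(-a)^{n-k}}{(n-k)!},\qquad n=0,1,2,\ldots,$$ where $\binom{x}{k}=x(x-1)\cdots(x-k+1)/k!$, so that $C_n^{(a)}$ is a polynomial in $x$ and may be evaluated at any real $x$ (for example $x=-1$). *)

(* Defs.v *)
From mathcomp Require Import all_boot all_order all_algebra.
From mathcomp Require Import all_classical all_reals all_analysis.
From mathcomp Require Import ring.

Set Implicit Arguments.
Unset Strict Implicit.
Unset Printing Implicit Defensive.
Import Order.TTheory GRing.Theory Num.Theory.
Import numFieldNormedType.Exports.

Local Open Scope classical_set_scope.
Local Open Scope ring_scope.

(* The binomial coefficient x(x-1)...(x-k+1)/k! as a polynomial in x. *)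
Definition binom_poly (R : realType) (k : nat) : {poly R} :=
  (k`!%:R)^-1 *: \prod_(i < k) ('X - (i%:R)%:P).

Definition charlier (R : realType) (a : R) (n : nat) : {poly R} :=
  \sum_(k < n.+1) ((- a) ^+ (n - k) / (n - k)`!%:R) *: binom_poly R k.

Definition poisson_weight (R : realType) (a : R) (x : nat) : R :=
  expR (- a) * a ^+ x / x`!%:R.

(* [limn] is total; the series converges for all polynomials f and g by
   [charlier_ip_cvg] below, so its value here is the sum of the series. *)
Definition charlier_ip (R : realType) (a N : R) (f g : {poly R}) : R :=
  limn (series (fun x : nat => poisson_weight a x * f.[x%:R] * g.[x%:R]))
  + N * f.[0] * g.[0].

(* C_n^{(a)}(x - 1) is the composition of C_n^{(a)} with 'X - 1. *)
Definition gen_charlier (R : realType) (a N : R) (n : nat) : {poly R} :=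
  (1 + N * (- 1) ^+ n * (charlier a n).[- 1]) *: charlier a n
  - (N * (- 1) ^+ n * (charlier a n).[0]) *: (charlier a n \Po ('X - 1)).

Lemma poisson_weightS (R : realType) (a : R) (x : nat) :
  poisson_weight a x.+1 * x.+1%:R = a * poisson_weight a x.
Proof.
rewrite /poisson_weight factS natrM exprS.
have x1 : x.+1%:R != 0 :> R by rewrite pnatr_eq0.
rewrite mulrCA -!mulrA; congr (_ * (_ * (_ * _))).
by rewrite invfM mulrC mulrA mulfV// mul1r.
Qed.

Lemma poisson_weight_gt0 (R : realType) (a : R) (x : nat) :
  0 < a -> 0 < poisson_weight a x.
Proof. by move=> a0; rewrite divr_gt0 ?mulr_gt0 ?expR_gt0 ?exprn_gt0. Qed.

Lemma poisson_series_cvg (R : realType) (a : R) (p : {poly R}) :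
  cvgn (series (fun x : nat => poisson_weight a x * p.[x%:R])).
Proof.
have cvg0 : cvgn (series (fun x : nat =>
    poisson_weight a x * (0 : {poly R}).[x%:R])).
  have -> : (fun x : nat => poisson_weight a x * (0 : {poly R}).[x%:R])
          = 0 *: exp_coeff a.
    by apply/funext => x; rewrite horner0 mulr0 -[RHS]/(0 * _) mul0r.
  by apply: is_cvg_seriesZ; exact: is_cvg_series_exp_coeff.
have [n] := ubnP (size p); elim: n p => // n IH p.
elim/poly_ind: p => [//|q c _ sz].
have -> : (fun x : nat => poisson_weight a x * (q * 'X + c%:P).[x%:R])
    = (fun x : nat => poisson_weight a x * (x%:R * q.[x%:R]))
      + (c * expR (- a)) *: exp_coeff a.
  apply/funext => x; rewrite !hornerE mulrDr -[RHS]/(_ + _).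
  congr (_ + _); first by rewrite [q.[_] * _]mulrC.
  rewrite -[RHS]/(_ * (_ / _)) /poisson_weight.
  by rewrite mulrC !mulrA.
apply: is_cvg_seriesD; last first.
  by apply: is_cvg_seriesZ; exact: is_cvg_series_exp_coeff.
have -> : series (fun x : nat => poisson_weight a x * (x%:R * q.[x%:R]))
  = fun m => series (a *: (fun x : nat => poisson_weight a x *
                                   (q \Po ('X + 1)).[x%:R])) m.-1.
  apply/funext => -[|m]; first by rewrite /series/= !big_nil.
  rewrite /series/= big_nat_recl//= mul0r mulr0 add0r.
  apply: eq_bigr => i _; rewrite mulrA poisson_weightS.
  rewrite -[RHS]/(a * (poisson_weight a i * (q \Po ('X + 1)).[i%:R])).
  by rewrite horner_comp !hornerE natr1.
have /cvg_ex[l hl] : cvgn (series (a *: (fun x : nat => poisson_weight a x *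
                                   (q \Po ('X + 1)).[x%:R]))).
  apply: is_cvg_seriesZ.
  have [->|q0] := eqVneq q 0; first by rewrite comp_poly0.
  apply: IH; rewrite size_comp_poly2 ?size_XaddC//.
  by move: sz; rewrite size_MXaddC (negbTE q0) /= ltnS.
by apply/cvg_ex; exists l; rewrite -cvg_shiftS.
Qed.

Lemma charlier_ip_cvg (R : realType) (a : R) (f g : {poly R}) :
  cvgn (series (fun x : nat => poisson_weight a x * f.[x%:R] * g.[x%:R])).
Proof.
rewrite (_ : (fun _ => _) =
    fun x : nat => poisson_weight a x * (f * g).[x%:R]).
  exact: poisson_series_cvg.
by apply/funext => x; rewrite hornerM mulrA.
Qed.

Lemma charlier_ipC (R : realType) (a N : R) (f g : {poly R}) :
  charlier_ip a N f g = charlier_ip a N g f.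
Proof.
rewrite /charlier_ip [N * _ * _]mulrAC; congr (limn (series _) + _).
by apply/funext => x; rewrite mulrAC.
Qed.

Lemma charlier_ip_linearl (R : realType) (a N c : R) (f g h : {poly R}) :
  charlier_ip a N (c *: f + g) h
  = c * charlier_ip a N f h + charlier_ip a N g h.
Proof.
rewrite /charlier_ip (_ : (fun _ => _) =
    c *: (fun x : nat => poisson_weight a x * f.[x%:R] * h.[x%:R])
    + (fun x : nat => poisson_weight a x * g.[x%:R] * h.[x%:R])).
  have cf := @charlier_ip_cvg R a f h.
  rewrite (lim_seriesD (is_cvg_seriesZ cf) (@charlier_ip_cvg R a g h)).
  rewrite (lim_seriesZ _ cf).
  by rewrite hornerD hornerZ -[_ *: limn _]/(_ * _); ring.
apply/funext => x; rewrite hornerD hornerZ.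
by rewrite -[RHS]/(c * (_ * _ * _) + _); ring.
Qed.

Lemma charlier_ip_gt0 (R : realType) (a N : R) (f : {poly R}) :
  0 < a -> 0 < N -> f != 0 -> 0 < charlier_ip a N f f.
Proof.
move=> a0 N0 f0.
set u := fun x : nat => poisson_weight a x * f.[x%:R] * f.[x%:R].
have u0 x : 0 <= u x.
  by rewrite /u -mulrA -expr2 mulr_ge0 ?sqr_ge0// ltW// poisson_weight_gt0.
have ule m : series u m <= limn (series u).
  apply: nondecreasing_cvgn_le; last exact: charlier_ip_cvg.
  by apply: nondecreasing_series => // n _ _; exact: u0.
have [x fx] : exists x : nat, f.[x%:R] != 0.
  apply: contrapT => /forallNP fx.
  have : (size [seq x%:R : R | x <- iota 0 (size f)] < size f)%N.
    apply: max_poly_roots => //.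
      by apply/allP => _ /mapP[x _ ->]; apply/negPn/negP; exact: fx.
    by rewrite map_inj_uniq ?iota_uniq//; exact: mulrIn (oner_neq0 _).
  by rewrite size_map size_iota ltnn.
rewrite /charlier_ip -/u ltr_wpDr//.
  by rewrite -mulrA -expr2 mulr_ge0 ?sqr_ge0// ltW.
apply: lt_le_trans (ule x.+1).
rewrite /series/= big_nat_recr//= ltr_wpDl ?sumr_ge0//.
by rewrite /u -mulrA -expr2 mulr_gt0 ?poisson_weight_gt0// exprn_even_gt0.
Qed.

(* Main.v *)
(** Let [L] be the mean under the Poisson law.  The weight satisfies
    [L (x q(x)) = a L (q(x+1))], which makes [f |-> x f(x-1) - a f(x)] adjoint
    to [a] times the forward difference; since it sends [C_n] to
    [(n+1) C_{n+1}], induction gives that [C_n] is orthogonal to all polynomials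
    of degree less than [n].  For [p(x) = p(0) + x q(x)] of degree less than
    [n], the part [x q(x)] does not see the mass at [0], and it is orthogonal to both
    [C_n(x)] and [C_n(x-1)] by the shift identity.  The constant part vanishes
    because [L (C_n(x-1)) = (-1)^n] and the value of the generalized polynomial
    at [0] is [(-a)^n / n!]. *)
Require Import Defs.
From HB Require Import structures.
From mathcomp Require Import all_boot all_order all_algebra.
From mathcomp Require Import all_classical all_reals all_analysis.
From mathcomp Require Import ring.
Import Order.TTheory GRing.Theory Num.Theory.
Import numFieldNormedType.Exports.

Local Open Scope ring_scope.

(** * The Poisson mean as a linear functional *)

Definition poisson_mean {R : realType} (a : R) (p : {poly R}) : R :=
  limn (series (fun x : nat => poisson_weight a x * p.[x%:R])).

Lemma charlier_ipE {R : realType} (a N : R) (f g : {poly R}) :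
  charlier_ip a N f g = poisson_mean a (f * g) + N * f.[0] * g.[0].
Proof.
rewrite /charlier_ip /poisson_mean; congr (limn (series _) + _).
by apply/funext => x; rewrite hornerM mulrA.
Qed.

(** With mass 0 at the origin and second argument 1, [charlier_ip] is the mean, so its linearity
    carries over. *)
Lemma poisson_mean_is_linear {R : realType} (a : R) :
  linear_for *%R (poisson_mean a).
Proof.
move=> c f g; have := charlier_ip_linearl a 0 c f g 1.
by rewrite !charlier_ipE !mulr1 !mul0r !addr0.
Qed.

HB.instance Definition _ (R : realType) (a : R) :=
  GRing.isLinear.Build R {poly R} R *%R (poisson_mean a)
    (poisson_mean_is_linear a).

Lemma poisson_meanZ {R : realType} (a c : R) (f : {poly R}) :
  poisson_mean a (c *: f) = c * poisson_mean a f.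
Proof. exact: linearZ. Qed.

Lemma poisson_mean1 {R : realType} (a : R) : poisson_mean a 1 = 1.
Proof.
rewrite /poisson_mean (_ : (fun _ => _) = expR (- a) *: exp_coeff a).
  rewrite (lim_seriesZ _ (is_cvg_series_exp_coeff a)).
  by rewrite -[LHS]/(expR (- a) * expR a) mulrC expRxMexpNx_1.
apply/funext => x; by rewrite hornerC mulr1 /poisson_weight -mulrA.
Qed.

(** The term at x = 0 vanishes, and [poisson_weightS] turns the term at x + 1 into a times a term of
    the shifted series. *)
Lemma poisson_mean_mulX {R : realType} (a : R) (q : {poly R}) :
  poisson_mean a ('X * q) = a * poisson_mean a (q \Po ('X + 1)).
Proof.
have cq := @poisson_series_cvg R a (q \Po ('X + 1)).
rewrite -[RHS](lim_seriesZ a cq).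
apply/cvg_lim => //; rewrite -cvg_shiftS /=.
rewrite (_ : (fun n => _) = series (a *: (fun x : nat =>
  poisson_weight a x * (q \Po ('X + 1)).[x%:R]))).
  exact: is_cvg_seriesZ.
apply/funext => m; rewrite /series/= big_nat_recl//=.
rewrite hornerM hornerX mul0r mulr0 add0r.
apply: eq_bigr => i _; rewrite hornerM hornerX mulrA poisson_weightS.
rewrite -[RHS]/(a * (poisson_weight a i * (q \Po ('X + 1)).[i%:R])).
by rewrite horner_comp !hornerE natr1.
Qed.

(** * Unit shifts of polynomials *)

Lemma comp_polyXB1K {R : realType} (f : {poly R}) :
  (f \Po ('X - 1)) \Po ('X + 1) = f.
Proof.
by rewrite -comp_polyA comp_polyB comp_polyX comp_polyC addrK comp_polyXr.
Qed.

Lemma poisson_mean_mulX_shift {R : realType} (a : R) (f q : {poly R}) :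
  poisson_mean a ('X * (q * (f \Po ('X - 1))))
  = a * poisson_mean a ((q \Po ('X + 1)) * f).
Proof. by rewrite poisson_mean_mulX comp_polyM comp_polyXB1K. Qed.

Lemma size_comp_XD1 {R : realType} (q : {poly R}) :
  size (q \Po ('X + 1)) = size q.
Proof. by rewrite size_comp_poly2 ?size_XaddC. Qed.

Lemma size_comp_XB1 {R : realType} (q : {poly R}) :
  size (q \Po ('X - 1)) = size q.
Proof. by rewrite size_comp_poly2 ?size_XsubC. Qed.

Lemma lead_coef_comp_monic2 {R : realType} (q m : {poly R}) :
  size m = 2 -> m \is monic -> lead_coef (q \Po m) = lead_coef q.
Proof.
move=> sm /monicP lm.
by rewrite lead_coef_comp ?sm// lm expr1n mulr1.
Qed.

(** A unit shift keeps the leading coefficient, so the top terms cancel. *)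
Lemma size_diff_lt {R : realType} (q : {poly R}) (n : nat) :
  (size q <= n.+1)%N -> (size ((q \Po ('X + 1%R)) - q)%R <= n)%N.
Proof.
move=> sq; apply/leq_sizeP => j; rewrite leq_eqVlt => /orP[/eqP <-|lt_nj].
  rewrite coefB; have [sn|sn] := eqVneq (size q) n.+1; last first.
    have sqn : (size q <= n)%N by rewrite -ltnS ltn_neqAle sn.
    by rewrite !nth_default ?subrr// size_comp_XD1.
  have := @lead_coef_comp_monic2 R q ('X + 1) (size_XaddC 1) (monicXaddC 1).
  by rewrite !lead_coefE size_comp_XD1 sn /= => ->; rewrite subrr.
by rewrite coefB !nth_default ?subrr// ?size_comp_XD1 (leq_trans sq).
Qed.

(** * Binomial polynomials *)

Lemma binom_poly0 {R : realType} : binom_poly R 0 = 1.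
Proof. by rewrite /binom_poly big_ord0 fact0 invr1 scale1r. Qed.

Lemma size_binom_poly {R : realType} (k : nat) : size (binom_poly R k) = k.+1.
Proof.
rewrite /binom_poly size_scale ?invr_eq0 ?pnatr_eq0 -?lt0n ?fact_gt0//.
by rewrite size_prod_XsubC /index_enum -enumT size_enum_ord.
Qed.

Lemma binom_polyS_mul {R : realType} (k : nat) :
  k.+1%:R *: binom_poly R k.+1 = 'X * (binom_poly R k \Po ('X - 1)).
Proof.
rewrite /binom_poly comp_polyZ scalerA factS natrM invfM mulrA.
rewrite divff ?pnatr_eq0// mul1r -scalerAr; congr (_ *: _).
rewrite big_ord_recl subr0; congr (_ * _).
rewrite rmorph_prod; apply: eq_bigr => i _.
rewrite /= comp_polyB comp_polyX comp_polyC /bump /= add1n -natr1 polyCD.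
ring.
Qed.

Lemma binom_polyS {R : realType} (k : nat) :
  k.+1%:R *: binom_poly R k.+1 = ('X - k%:R%:P) * binom_poly R k.
Proof.
rewrite /binom_poly scalerA factS natrM invfM mulrA.
rewrite divff ?pnatr_eq0// mul1r -scalerAr; congr (_ *: _).
by rewrite big_ord_recr mulrC.
Qed.

(** After multiplication by k + 1, all terms share the factor [binom_poly R k] at x - 1, and the
    cofactors satisfy x = (x - 1 - k) + (k + 1). *)
Lemma binom_poly_pascal {R : realType} (k : nat) :
  binom_poly R k.+1
  = (binom_poly R k.+1 \Po ('X - 1)) + (binom_poly R k \Po ('X - 1)).
Proof.
have k0 : k.+1%:R != 0 :> R by rewrite pnatr_eq0.
apply: (scalerI k0); rewrite scalerDr binom_polyS_mul.
rewrite -comp_polyZ binom_polyS comp_polyM comp_polyB comp_polyX comp_polyC.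
by rewrite -mul_polyC -natr1 polyCD; ring.
Qed.

Lemma binom_poly_at0 {R : realType} (k : nat) :
  (binom_poly R k).[0] = (k == 0)%:R.
Proof.
case: k => [|k]; first by rewrite binom_poly0 hornerC.
by rewrite /binom_poly hornerZ big_ord_recl subr0 hornerM hornerX mul0r mulr0.
Qed.

Lemma binom_poly_atN1 {R : realType} (k : nat) :
  (binom_poly R k).[-1] = (-1) ^+ k.
Proof.
elim: k => [|k IH]; first by rewrite binom_poly0 hornerC.
have k0 : k.+1%:R != 0 :> R by rewrite pnatr_eq0.
apply: (mulfI k0); rewrite -hornerZ binom_polyS hornerM IH !hornerE exprS.
by rewrite -natr1; ring.
Qed.

(** * Special values and recurrences of the Charlier polynomials *)

Lemma charlier0 {R : realType} (a : R) : charlier a 0 = 1.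
Proof.
by rewrite /charlier big_ord1 binom_poly0 subnn expr0 fact0 divr1 scale1r.
Qed.

Lemma charlier_recr {R : realType} (a : R) (n : nat) :
  charlier a n = binom_poly R n +
    \sum_(k < n) ((- a) ^+ (n - k) / (n - k)`!%:R) *: binom_poly R k.
Proof.
by rewrite /charlier big_ord_recr /= subnn expr0 fact0 divr1 scale1r addrC.
Qed.

Lemma size_charlier {R : realType} (a : R) (n : nat) :
  size (charlier a n) = n.+1.
Proof.
rewrite charlier_recr size_polyDl ?size_binom_poly//.
rewrite ltnS; apply: (leq_trans (size_sum _ _ _)); apply/bigmax_leqP => i _.
by rewrite (leq_trans (size_scale_leq _ _))// size_binom_poly.
Qed.

Lemma charlier_at0 {R : realType} (a : R) (n : nat) :
  (charlier a n).[0] = (- a) ^+ n / n`!%:R.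
Proof.
rewrite /charlier horner_sum big_ord_recl hornerZ binom_poly_at0 mulr1 subn0.
by rewrite big1 ?addr0// => i _; rewrite hornerZ binom_poly_at0 mulr0.
Qed.

Lemma charlier_atN1 {R : realType} (a : R) (n : nat) :
  (-1) ^+ n * (charlier a n).[-1] = \sum_(j < n.+1) a ^+ j / j`!%:R.
Proof.
rewrite /charlier horner_sum mulr_sumr (reindex_inj rev_ord_inj) /=.
apply: eq_bigr => i _; rewrite subSS hornerZ binom_poly_atN1.
have le_in : (i <= n)%N by rewrite -ltnS.
(* Splitting n = (n - i) + i makes every sign occur squared. *)
rewrite subKn// -{1}(subnK le_in) exprD (exprNn a).
have signK k : (-1) ^+ k * (-1) ^+ k = 1 :> R.
  by rewrite -exprMn mulrNN mulr1 expr1n.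
transitivity (((-1) ^+ (n - i) * (-1) ^+ (n - i)) * ((-1) ^+ i * (-1) ^+ i)
  * (a ^+ i / i`!%:R)); last by rewrite !signK !mul1r.
ring.
Qed.

(** Pascal's rule applies term by term; the k = 0 term is constant, hence fixed by the shift. *)
Lemma charlier_pascal {R : realType} (a : R) (n : nat) :
  charlier a n.+1
  = (charlier a n.+1 \Po ('X - 1)) + (charlier a n \Po ('X - 1)).
Proof.
rewrite /charlier !rmorph_sum /= !(big_ord_recl n.+1) /=.
rewrite binom_poly0 comp_polyZ comp_polyC -addrA; congr (_ + _).
rewrite -big_split /=; apply: eq_bigr => i _.
rewrite /bump /= add1n subSS [X in X + _]comp_polyZ [X in _ + X]comp_polyZ.
by rewrite -scalerDr -binom_poly_pascal.
Qed.

Lemma charlier_raise {R : realType} (a : R) (n : nat) :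
  'X * (charlier a n \Po ('X - 1)) - a *: charlier a n
  = n.+1%:R *: charlier a n.+1.
Proof.
set c := fun j : nat => (- a) ^+ j / j`!%:R : R.
have cS j : j.+1%:R * c j.+1 = - a * c j.
  rewrite /c exprS factS natrM.
  by field; rewrite addrC natr1 !pnatr_eq0 -lt0n fact_gt0.
(* Write n + 1 = k + (n + 1 - k) in the k-th term: the factor k yields x C_n(x-1) by absorption, and
   the factor n + 1 - k yields -a C_n(x) by [cS]. *)
have -> : n.+1%:R *: charlier a n.+1 =
   \sum_(k < n.+2) (k%:R * c (n.+1 - k)%N) *: binom_poly R k
   + \sum_(k < n.+2) ((n.+1 - k)%:R * c (n.+1 - k)%N) *: binom_poly R k.
  rewrite -big_split /= /charlier scaler_sumr; apply: eq_bigr => k _.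
  have le_kn : (k <= n.+1)%N by rewrite -ltnS.
  rewrite -scalerDl -(mulrDl k%:R (n.+1 - k)%:R) -(natrD _ k) (subnKC le_kn).
  exact: scalerA.
congr (_ + _).
  rewrite big_ord_recl mul0r scale0r add0r /charlier rmorph_sum mulr_sumr.
  apply: eq_bigr => k _ /=; rewrite /bump /= add1n subSS comp_polyZ -scalerAr.
  by rewrite -binom_polyS_mul scalerA mulrC.
rewrite big_ord_recr /= subnn mul0r scale0r addr0 -scaleNr scaler_sumr.
apply: eq_bigr => k _; have le_kn : (k <= n)%N by rewrite -ltnS.
by rewrite subSn// cS scalerA.
Qed.

(** * Orthogonality of the classical Charlier polynomials *)

Lemma poisson_mean_charlier_mul {R : realType} (a : R) (n : nat)
    (q : {poly R}) :
  (size q <= n)%N -> poisson_mean a (q * charlier a n) = 0.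
Proof.
elim: n q => [|n IH] q sq.
  by move: sq; rewrite leqn0 size_poly_eq0 => /eqP ->; rewrite mul0r linear0.
have n0 : n.+1%:R != 0 :> R by rewrite pnatr_eq0.
(* Raising and the shift identity give (n+1) L(q C_{n+1}) = a L((q(x+1) - q(x)) C_n), where the
   difference has lower degree. *)
apply: (mulfI n0); rewrite mulr0 -poisson_meanZ scalerAr.
rewrite -charlier_raise mulrBr mulrCA linearB /= poisson_mean_mulX_shift.
rewrite -scalerAr poisson_meanZ -mulrBr -linearB /= -mulrBl IH ?mulr0//.
exact: size_diff_lt.
Qed.

Lemma poisson_mean_charlier {R : realType} (a : R) (n : nat) :
  (0 < n)%N -> poisson_mean a (charlier a n) = 0.
Proof.
move=> n0; rewrite -[charlier a n]mul1r.
by rewrite poisson_mean_charlier_mul ?size_poly1.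
Qed.

(** Taking means in [charlier_pascal] kills the left side, so each step in n flips the sign. *)
Lemma poisson_mean_charlier_shift {R : realType} (a : R) (n : nat) :
  poisson_mean a (charlier a n \Po ('X - 1)) = (-1) ^+ n.
Proof.
elim: n => [|n IH]; first by rewrite charlier0 comp_polyC poisson_mean1.
have := poisson_mean_charlier a n.+1 (ltn0Sn n).
rewrite {1}charlier_pascal linearD /= IH => /eqP.
by rewrite addr_eq0 exprS mulN1r => /eqP.
Qed.

(** * The generalized polynomials: degree and orthogonality *)

Lemma gen_charlierE {R : realType} (a N : R) (n : nat) :
  gen_charlier a N n =
    (1 + N * \sum_(j < n.+1) a ^+ j / j`!%:R) *: charlier a n
    - (N * (a ^+ n / n`!%:R)) *: (charlier a n \Po ('X - 1)).
Proof.
rewrite /gen_charlier -!mulrA charlier_atN1 charlier_at0.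
congr (_ - (N * _) *: _).
by rewrite mulrA -exprMn mulN1r opprK.
Qed.

(** At x = 0 the two contributions of N are both N (-1)^n C_n(-1) C_n(0) and cancel. *)
Lemma gen_charlier_at0 {R : realType} (a N : R) (n : nat) :
  (gen_charlier a N n).[0] = (- a) ^+ n / n`!%:R.
Proof.
rewrite /gen_charlier hornerD hornerN !hornerZ horner_comp !hornerE.
by rewrite -charlier_at0; ring.
Qed.

Lemma size_gen_charlier {R : realType} (a N : R) (n : nat) :
  0 < a -> 0 < N -> size (gen_charlier a N n) = n.+1.
Proof.
move=> a0 N0; apply/eqP; rewrite eqn_leq; apply/andP; split.
  rewrite /gen_charlier (leq_trans (size_polyD _ _))// geq_max size_polyN.
  by rewrite !(leq_trans (size_scale_leq _ _))// ?size_comp_XB1 size_charlier.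
suff c0 : (gen_charlier a N n)`_n != 0.
  by rewrite ltnNge; apply: contra c0 => /leq_sizeP ->.
have lc : (charlier a n)`_n != 0.
  have := lead_coef_eq0 (charlier a n).
  rewrite lead_coefE size_charlier /= => ->.
  by rewrite -size_poly_eq0 size_charlier.
have ls : (charlier a n \Po ('X - 1))`_n = (charlier a n)`_n.
  have := @lead_coef_comp_monic2 R (charlier a n) ('X - 1) (size_XsubC 1)
    (monicXsubC 1).
  by rewrite !lead_coefE size_comp_XB1 size_charlier.
rewrite gen_charlierE coefB !coefZ ls -mulrBl mulf_neq0//.
(* The shifted polynomial cancels the j = n term, leaving the factor 1 + N sum_{j<n} a^j/j!, which
   is positive. *)
rewrite big_ord_recr /= mulrDr addrA addrK gt_eqF// ltr_pwDl//.
rewrite mulr_ge0 ?sumr_ge0 ?(ltW N0)// => i _.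
by rewrite divr_ge0// exprn_ge0// ltW.
Qed.

Lemma gen_charlier_orthogonal {R : realType} (a N : R) (n : nat)
    (p : {poly R}) :
  (size p <= n)%N -> charlier_ip a N p (gen_charlier a N n) = 0.
Proof.
(* [poly_ind] serves as the case split p = q X + c. *)
elim/poly_ind: p => [|q c _] sp.
  by rewrite charlier_ipE mul0r linear0 horner0 mulr0 mul0r addr0.
have sq : (size q <= n)%N.
  have [->|q0] := eqVneq q 0; first by rewrite size_poly0.
  by move: sp; rewrite size_MXaddC (negbTE q0) /=; exact: ltnW.
rewrite charlier_ipE gen_charlier_at0 gen_charlierE !hornerE.
rewrite mulrBr -!scalerAr linearB /= !poisson_meanZ poisson_mean_charlier_mul//.
rewrite mulr0 sub0r mulrDl linearD /= [q * 'X]mulrC -(mulrA 'X).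
rewrite poisson_mean_mulX_shift.
rewrite poisson_mean_charlier_mul ?size_comp_XD1 ?sq//.
rewrite mulr0 add0r mul_polyC poisson_meanZ poisson_mean_charlier_shift.
(* What remains is -N (a^n/n!) c (-1)^n from the mean and N c (-a)^n/n! from the mass at 0. *)
by rewrite (exprNn a); ring.
Qed.

Theorem mainTheorem1 (R : realType) (a N : R) (ha : 0 < a) (hN : 0 < N) :
  (forall n : nat, size (gen_charlier a N n) = n.+1) /\
  (forall m n : nat, m <> n ->
     charlier_ip a N (gen_charlier a N m) (gen_charlier a N n) = 0).
Proof.
split=> [n|m n]; first exact: size_gen_charlier.
have ltC i j : (i < j)%N ->
    charlier_ip a N (gen_charlier a N i) (gen_charlier a N j) = 0.
  by move=> ij; rewrite gen_charlier_orthogonal ?size_gen_charlier.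
have [mn _|nm _|//] := ltngtP m n; first exact: ltC.
by rewrite charlier_ipC ltC.
Qed.
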